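(* Every bipartitioned circular interval graph satisfies Frankl's conjecture: if $G$ is a bipartitioned circular interval graph with bipartition classes $U,W$ (the two classes of the partition used to construct it) and $G$ has at least one edge, then each of $U$ and $W$ contains a vertex belonging to at most half of the maximal stable sets of $G$.
   Context: A circular interval graph is defined by a finite subset $V$ of a circle (the vertex set) and a set $\mathcal I$ of subintervals (arcs) of the circle; two vertices are adjacent if some interval of $\mathcal I$ contains both. A bipartitioned circular interval graph is obtained from a circular interval graph by partitioning its vertex set into two classes $U,W$ and deleting every edge with both endvertices in the same class. A set of vertices is stable if no two are adjacent; maximal means maximal under inclusion. (Edgeless graphs are considered to satisfy Frankl's conjecture trivially.) *)

(* Defs.v *)
From mathcomp Require Import all_boot all_order all_algebra finmap.
From mathcomp Require Import all_classical all_reals all_analysis.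

Set Implicit Arguments.
Unset Strict Implicit.
Unset Printing Implicit Defensive.

Import Order.TTheory GRing.Theory Num.Theory.

Local Open Scope classical_set_scope.
Local Open Scope ring_scope.

Section StableSets.
Variables (T : finType) (e : rel T).

Definition stable_set (S : {set T}) : bool :=
  [forall x in S, forall y in S, ~~ e x y].

Definition max_stable_sets : {set {set T}} :=
  [set S : {set T} | maxset stable_set S]%SET.

Definition in_at_most_half (x : T) : Prop :=
  (2 * #|[set S in max_stable_sets | x \in S]%SET| <= #|max_stable_sets|)%N.

End StableSets.

Section CircularIntervalGraphs.
Variable R : realType.

Definition circle : set (R * R) := [set p | p.1 ^+ 2 + p.2 ^+ 2 = 1].

(* The images of the intervals of the real line under the covering map; the
   interval may be open, closed or half-open, and a long one may wrap around
   and cover the whole circle. *)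
Definition circle_arc (A : set (R * R)) : Prop :=
  exists2 J : set R, is_interval J & A = [set (cos t, sin t) | t in J].

Definition circular_interval_adj (V : {fset R * R}) (I : set (set (R * R))) :
    rel V :=
  fun x y => (x != y) && `[< exists2 A, I A & A (val x) /\ A (val y) >].

End CircularIntervalGraphs.

Definition del_class_edges (T : finType) (U W : {set T}) (e : rel T) : rel T :=
  fun x y => [&& e x y, ~~ ((x \in U) && (y \in U))
                      & ~~ ((x \in W) && (y \in W))].

Definition bipartitioned_circular_interval_adj (R : realType)
    (V : {fset R * R}) (I : set (set (R * R))) (U W : {set V}) : rel V :=
  del_class_edges U W (circular_interval_adj I).

(* Main.v *)
(** Let x be a vertex with neighbours y and z such that every vertex at distance
two from x is adjacent to y or to z.  A maximal stable set containing y and z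
contains all of N(x), so deleting N(x) (and completing on the side of x) injects
these sets into the maximal stable sets avoiding both y and z; hence y or z lies
in at most half of them.

To find such a triple with y, z in a prescribed class, take x non-isolated in the
other class with a non-neighbour p in the prescribed class.  No arc through x
contains p, so after cutting the circle at p the first and the last neighbour of
x serve as y and z.  If there is no such pair x, p, then each non-isolated vertex
of the other class is adjacent to the whole prescribed class, and y = z can be
any vertex of the latter. *)

Require Import Defs.
From mathcomp Require Import all_boot all_order all_algebra finmap.
From mathcomp Require Import all_classical all_reals all_analysis.
From mathcomp Require Import zify lra.

Set Implicit Arguments.
Unset Strict Implicit.
Unset Printing Implicit Defensive.

Import Order.TTheory GRing.Theory Num.Theory.

Local Open Scope classical_set_scope.
Local Open Scope ring_scope.

(** * Maximal stable sets as dominating stable sets *)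

Section MaximalStableSets.
Variables (T : finType) (e : rel T).
Hypotheses (e_sym : symmetric e) (e_irr : irreflexive e).

Lemma stable_setP (S : {set T}) :
  reflect (forall u v, u \in S -> v \in S -> ~~ e u v) (stable_set e S).
Proof.
apply: (iffP forall_inP) => [h u v uS vS|h u uS].
  by move/forall_inP: (h u uS); exact.
by apply/forall_inP => v; exact: h.
Qed.

Lemma max_stable_setsP (S : {set T}) :
  reflect ((forall u v, u \in S -> v \in S -> ~~ e u v) /\
           forall v, v \notin S -> exists2 u, u \in S & e u v)
          (S \in max_stable_sets e).
Proof.
rewrite inE; apply: (iffP maxsetP) => [[/stable_setP Sst Smax]|[Sst Smax]].
  split=> // v vS; apply/exists_inP; apply: contraT => /exists_inPn nadj.
  have /Smax : stable_set e (v |: S)%SET.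
    apply/stable_setP => a b /setU1P[->|aS] /setU1P[->|bS].
    - by rewrite e_irr.
    - by rewrite e_sym nadj.
    - exact: nadj.
    - exact: Sst.
  by move=> /(_ (finset.subsetUr _ _)) vSS; move: vS; rewrite -vSS setU11.
split=> [|B /stable_setP Bst SB]; first exact/stable_setP.
apply/eqP; rewrite finset.eqEsubset SB andbT; apply/fintype.subsetP => v vB.
apply: contraT => /Smax[u uS uv].
by have := Bst u v (fintype.subsetP SB u uS) vB; rewrite uv.
Qed.

End MaximalStableSets.

(** * Counting maximal stable sets in a bipartite graph *)

Section BipartiteRareVertex.
Variables (T : finType) (e : rel T) (U : {set T}).
Hypotheses (e_sym : symmetric e)
           (e_bip : forall u v, e u v -> (u \in U) = (v \notin U)).

Lemma bipartite_irreflexive : irreflexive e.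
Proof. by move=> u; apply/negP => /e_bip; case: (u \in U). Qed.

Let maxP := max_stable_setsP e_sym bipartite_irreflexive.

(* The maximal stable set whose trace on U is that of S without the
   neighbours of x. *)
Definition drop_neighbours (x : T) (S : {set T}) : {set T} :=
  let B := [set w in S | (w \in U) && ~~ e x w]%SET in
  (B :|: [set u | (u \notin U) && [forall w in B, ~~ e u w]])%SET.

Lemma mem_drop_neighbours x S w : w \in U ->
  (w \in drop_neighbours x S) = (w \in S) && ~~ e x w.
Proof. by move=> wU; rewrite !inE wU orbF. Qed.

Lemma drop_neighbours_max x S : x \notin U ->
  S \in max_stable_sets e -> drop_neighbours x S \in max_stable_sets e.
Proof.
move=> xU /maxP[Sst Smax]; apply/maxP; split.
  move=> u v uD vD; apply/negP => uv.
  wlog uU : u v uD vD uv / u \in U.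
    move=> wl; case: (boolP (u \in U)) => [|uU]; first exact: wl uv.
    apply: (wl v u) => //; first by rewrite e_sym.
    by move: (e_bip uv); rewrite (negbTE uU) => /esym/negbFE.
  have vU : v \notin U by rewrite -(e_bip uv).
  move: vD; rewrite !inE (negbTE vU) andbF /= => /forall_inP /(_ u).
  rewrite e_sym uv => /(_ _)/negP; apply=> //.
  by move: uD; rewrite mem_drop_neighbours // inE uU.
move=> v; case: (boolP (v \in U)) => vU; last first.
  rewrite !inE vU (negbTE vU) andbF /= => /forall_inPn[w].
  rewrite inE => /and3P[wS wU xw]; rewrite negbK => vw; exists w.
    by rewrite mem_drop_neighbours // wS.
  by rewrite e_sym.
(* A vertex v of U was either outside S already, and then its neighbour in S lies outside U and
   survives, or it was removed as a neighbour of x, and then x itself dominates it. *)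
rewrite mem_drop_neighbours // negb_and negbK => /orP[/Smax[u uS uv]|xv].
  exists u => //; rewrite !inE uS (e_bip uv) vU /=.
  by apply/forall_inP => w; rewrite inE => /andP[wS _]; exact: Sst.
exists x => //; rewrite !inE xU (negbTE xU) andbF /=.
by apply/forall_inP => w; rewrite inE => /and3P[].
Qed.

(** Outside U, a maximal stable set consists of exactly those vertices that have no neighbour in its
    trace on U. *)
Lemma max_stable_eq_trace S1 S2 :
  S1 \in max_stable_sets e -> S2 \in max_stable_sets e ->
  (forall w, w \in U -> (w \in S1) = (w \in S2)) -> S1 = S2.
Proof.
move=> S1max S2max eqU.
suff sub S S' : S \in max_stable_sets e -> S' \in max_stable_sets e ->
    (forall w, w \in U -> (w \in S) = (w \in S')) -> S \subset S'.
  by apply/eqP; rewrite finset.eqEsubset !sub // => w /eqU.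
move=> /maxP[Sst _] /maxP[_ S'max] SS'; apply/fintype.subsetP => u uS.
case: (boolP (u \in U)) => uU; first by rewrite -SS'.
apply: contraT => /S'max[w wS' wu]; have wU : w \in U by rewrite (e_bip wu).
by move: wS'; rewrite -SS' // => /Sst/(_ uS); rewrite wu.
Qed.

(* A maximal stable set containing both y and z contains all of N(x), hence is
   determined by its image under drop_neighbours, which avoids both y and z. *)
Lemma rare_neighbour x y z : x \notin U -> e x y -> e x z ->
  (forall u v, e x v -> e u v -> e u y || e u z) ->
  in_at_most_half e y \/ in_at_most_half e z.
Proof.
move=> xU xy xz cov; set M := max_stable_sets e.
have nbrU v : e x v -> v \in U by move/e_bip; rewrite (negbTE xU) => /esym/negbFE.
have [yU zU] := (nbrU _ xy, nbrU _ xz).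
have nbrS S v : S \in M -> y \in S -> z \in S -> e x v -> v \in S.
  move=> /maxP[Sst Smax] yS zS xv; apply: contraT => /Smax[u uS uv].
  case/orP: (cov _ _ xv uv) => uw; first by have := Sst _ _ uS yS; rewrite uw.
  by have := Sst _ _ uS zS; rewrite uw.
pose Y := [set S in M | y \in S]%SET; pose Z := [set S in M | z \in S]%SET.
have YE S : (S \in Y) = (S \in M) && (y \in S) by rewrite finset.in_set.
have ZE S : (S \in Z) = (S \in M) && (z \in S) by rewrite finset.in_set.
have leYZ : (#|Y :&: Z| <= #|(M :\: Y) :\: Z|)%N.
  rewrite -(@card_in_imset _ _ (drop_neighbours x) (Y :&: Z)%SET); last first.
    move=> S1 S2; rewrite !finset.in_setI !YE !ZE => /andP[/andP[M1 y1] /andP[_ z1]].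
    move=> /andP[/andP[M2 y2] /andP[_ z2]] eqD.
    apply: max_stable_eq_trace => // w wU.
    have := mem_drop_neighbours x S1 wU; rewrite eqD mem_drop_neighbours //.
    case xw : (e x w); last by rewrite !andbT.
    by rewrite !(nbrS _ w).
  apply/subset_leq_card/fintype.subsetP => _ /imsetP[S SYZ ->].
  move: SYZ; rewrite finset.in_setI !finset.in_setD !YE !ZE => /andP[/andP[SM _] _].
  by rewrite !mem_drop_neighbours // xy xz drop_neighbours_max // !andbF.
have subY : Y \subset M by apply/fintype.subsetP => S; rewrite YE => /andP[].
(* By [leYZ], |Y| + |Z| = |Y :|: Z| + |Y :&: Z| is at most |M|, so the smaller of Y and Z has at
   most half the size of M. *)
have := cardsID Y M; have := cardsID Z Y; have := cardsID Y Z.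
have := cardsID Z (M :\: Y).
rewrite (finset.setIidPr subY) (_ : (M :\: Y) :&: Z = Z :\: Y)%SET; last first.
  by apply/setP => S; rewrite finset.in_setI !finset.in_setD !YE !ZE; do 3 case: (_ \in _).
rewrite [(Z :&: Y)%SET]finset.setIC /in_at_most_half -/M -/Y -/Z; lia.
Qed.

End BipartiteRareVertex.

(** * Arcs on a circle cut open into a line *)

Section CircularIntervalOrder.
Context {d : Order.disp_t} {L : orderType d} {T : finType}.
Variables (theta : T -> L) (arcs : set (set T)) (U : {set T}) (e : rel T).
(** With [theta] as position after the cut, an arc joins two of its points either directly or across
    the cut. *)
Hypothesis arcs_dichotomy : forall A u v, arcs A -> A u -> A v ->
  (theta u <= theta v)%O ->
  (forall q, (theta u <= theta q <= theta v)%O -> A q) \/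
  (forall q, (theta q <= theta u)%O \/ (theta v <= theta q)%O -> A q).
Hypothesis e_arcs : forall u v,
  e u v <-> (u \in U) = (v \notin U) /\ exists2 A, arcs A & A u /\ A v.

Lemma extreme_neighbours_cover p x y z : x \notin U ->
  (forall q, theta p <= theta q)%O -> (forall A, arcs A -> A x -> ~ A p) ->
  e x y -> e x z ->
  (forall v, e x v -> theta y <= theta v <= theta z)%O ->
  forall u v, e x v -> e u v -> e u y || e u z.
Proof.
move=> xU p_min x_p xy xz extr u v xv uv.
have nbrU w : e x w -> w \in U.
  by move=> /e_arcs[+ _]; rewrite (negbTE xU) => /esym/negbFE.
have uU : u \notin U by have [-> _] := (e_arcs u v).1 uv; rewrite nbrU.
have adj w A : e x w -> arcs A -> A u -> A w -> e u w.
  move=> xw FA Au Aw; apply/e_arcs; split; last by exists A.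
  by rewrite (negbTE uU) nbrU.
(* An arc through x cannot run across the cut, as it would then contain p, the least point. *)
have between A w q : arcs A -> A x -> A w ->
    (theta w <= theta q <= theta x \/ theta x <= theta q <= theta w)%O -> A q.
  move=> FA Ax Aw [] wq.
    have [h|h] := arcs_dichotomy FA Aw Ax (le_trans (andP wq).1 (andP wq).2).
      exact: h.
    by case: (x_p A FA Ax); apply: h; left.
  have [h|h] := arcs_dichotomy FA Ax Aw (le_trans (andP wq).1 (andP wq).2).
    exact: h.
  by case: (x_p A FA Ax); apply: h; left.
(* The arc joining x to y covers u if u lies before x; otherwise the arc joining x to z does. *)
have inside : (theta y <= theta u <= theta z)%O -> e u y || e u z.
  move=> /andP[yu uz]; have [_ [A FA [Ax Ay]]] := (e_arcs x y).1 xy.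
  have [_ [B FB [Bx Bz]]] := (e_arcs x z).1 xz.
  have [ux|xu] := leP (theta u) (theta x).
    rewrite (adj y A) //; apply: (between A y) => //; left; exact/andP.
  rewrite (adj z B) ?orbT //; apply: (between B z) => //; right.
  by rewrite uz ltW.
have /andP[yv vz] := extr v xv.
(* Since v lies between y and z, the arc joining u and v reaches y or z if it crosses the cut, or if
   u lies outside the range from y to z; otherwise [inside] applies. *)
have [_ [A FA [Au Av]]] := (e_arcs u v).1 uv.
have [uv'|/ltW vu] := leP (theta u) (theta v).
  have [h|h] := arcs_dichotomy FA Au Av uv'; last first.
    by rewrite (adj z A) ?orbT //; apply: h; right.
  have [uy|/ltW yu] := leP (theta u) (theta y).
    by rewrite (adj y A) //; apply: h; rewrite uy.
  by apply: inside; rewrite yu (le_trans uv').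
have [h|h] := arcs_dichotomy FA Av Au vu; last first.
  by rewrite (adj y A) //; apply: h; left.
have [uz|/ltW zu] := leP (theta u) (theta z).
  by apply: inside; rewrite uz (le_trans yv).
by rewrite (adj z A) ?orbT //; apply: h; rewrite zu vz.
Qed.

End CircularIntervalOrder.

(** * Angles and arcs of the circle *)

Section Angles.
Variable R : realType.
Implicit Types (a r s t : R) (k : int).

Definition circle_point t : R * R := (cos t, sin t).

Lemma circle_pointDz t k :
  circle_point (t + k%:~R * (pi *+ 2)) = circle_point t.
Proof.
have nat_period (n : nat) s :
    circle_point (s + n%:R * (pi *+ 2)) = circle_point s.
  rewrite mulr_natl /circle_point.
  by rewrite (periodicn (@cosD2pi R)) (periodicn (@sinD2pi R)).
case: k => n; first exact: nat_period.
by rewrite NegzE mulrNz mulNr -[LHS](nat_period n.+1) subrK.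
Qed.

Lemma angle_reduction a t :
  exists k, a <= t + k%:~R * (pi *+ 2) < a + pi *+ 2.
Proof.
have pi2 : 0 < pi *+ 2 :> R by rewrite mulrn_wgt0 // pi_gt0.
exists (- Num.floor ((t - a) / (pi *+ 2))).
have := floor_itv ((t - a) / (pi *+ 2)); set m := Num.floor _ => /andP[].
rewrite intrD1 ler_pdivlMr // ltr_pdivrMr // mulrDl mul1r mulrNz mulNr.
set q := _%:~R * _; lra.
Qed.

Lemma circle_point_inj s t : circle_point s = circle_point t ->
  exists k, s = t + k%:~R * (pi *+ 2).
Proof.
case=> cst sst; have [k] := angle_reduction 0 (s - t).
set r := _ + _ => /andP[r0]; rewrite add0r => rpi.
have cr : cos r = 1.
  have [] := circle_pointDz (s - t) k; rewrite -/r => -> _.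
  by rewrite cosB cst sst -!expr2 cos2Dsin2.
have pi0 := pi_gt0 R.
(* Cosine is injective on [0, pi] only, so an r beyond pi is reflected to 2 pi - r. *)
have zero u : 0 <= u <= pi -> cos u = 1 -> u = 0.
  move=> ui cu; apply: cos_inj; rewrite ?cos0 // in_itv /=; lra.
suff r_eq0 : r = 0 by exists (- k); move: r_eq0; rewrite mulrNz mulNr /r; lra.
have [rle|rgt] := leP r pi; first by apply: zero; rewrite ?r0.
suff : pi *+ 2 - r = 0 by lra.
apply: zero; first lra.
by rewrite cosB cos2pi sin2pi cr mul1r mul0r addr0.
Qed.

Lemma circle_point_surj a q : circle q ->
  exists2 t, a <= t < a + pi *+ 2 & q = circle_point t.
Proof.
case: q => c s /= cs1; have {}cs1 : c ^+ 2 + s ^+ 2 = 1 := cs1.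
have c1 : -1 <= c <= 1 by nra.
suff [t ->] : exists t, (c, s) = circle_point t.
  have [k tk] := angle_reduction a t.
  by exists (t + k%:~R * (pi *+ 2)) => //; rewrite circle_pointDz.
have cacos : cos (acos c) = c by apply: acosK; rewrite in_itv.
have sacos : sin (acos c) = `|s|.
  by rewrite sin_acos // (_ : 1 - c ^+ 2 = s ^+ 2) ?sqrtr_sqr //; lra.
have [s0|s0] := leP 0 s.
  by exists (acos c); rewrite /circle_point cacos sacos ger0_norm.
exists (- acos c); rewrite /circle_point cosN sinN cacos sacos.
by rewrite ltr0_norm // opprK.
Qed.

(** The arc lifts to an interval J containing s + 2 pi k and t + 2 pi l. If k <= l, J contains a
    translate of [s, t]; if k > l, it contains a translate of [t, s + 2 pi]. *)
Lemma circle_arc_dichotomy A a s t : circle_arc A ->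
  A (circle_point s) -> A (circle_point t) ->
  a <= s -> s <= t -> t < a + pi *+ 2 ->
  (forall r, s <= r <= t -> A (circle_point r)) \/
  (forall r, a <= r < a + pi *+ 2 -> r <= s \/ t <= r -> A (circle_point r)).
Proof.
have pi2 : 0 < pi *+ 2 :> R by rewrite mulrn_wgt0 // pi_gt0.
move=> [J Jitv ->] [s' Js' /circle_point_inj[k s'E]].
move=> [t' Jt' /circle_point_inj[l t'E]] le_as le_st lt_ta.
have lift r m : J (r + m%:~R * (pi *+ 2)) ->
    [set (cos t, sin t) | t in J] (circle_point r).
  by move=> Jr; exists (r + m%:~R * (pi *+ 2)) => //; exact: circle_pointDz.
have [kl|lk] := leP k l.
  have klp : k%:~R * (pi *+ 2) <= l%:~R * (pi *+ 2) :> R.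
    by rewrite ler_pM2r ?ler_int.
  left=> r /andP[sr rt]; apply: (lift _ k); apply: (Jitv _ _ Js' Jt').
  by rewrite s'E t'E; lra.
have lkp : l%:~R * (pi *+ 2) + pi *+ 2 <= k%:~R * (pi *+ 2) :> R.
  rewrite -[X in _ + X]mul1r -mulrDl ler_pM2r //.
  by rewrite -intrD1 ler_int; lia.
right=> r /andP[ar ra] [rs|tr].
  apply: (lift _ k); apply: (Jitv _ _ Jt' Js').
  by rewrite s'E t'E; lra.
(* Points from t on precede the cut, so they lie one turn lower in J than those up to s. *)
apply: (lift _ (k - 1)); apply: (Jitv _ _ Jt' Js').
by rewrite s'E t'E intrB mulrBl mul1r; lra.
Qed.

End Angles.

(** * A rare vertex in a prescribed class *)

Lemma rare_vertex_in_class (R : realType) (V : {fset R * R})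
    (I : set (set (R * R))) (U : {set V}) (e : rel V) :
  (forall p, p \in V -> circle p) -> (forall A, I A -> circle_arc A) ->
  (forall u v, e u v <-> (u \in U) = (v \notin U) /\
                         exists2 A, I A & A (val u) /\ A (val v)) ->
  (exists x y, e x y) ->
  exists2 w, w \in U & in_at_most_half e w.
Proof.
move=> V_circle I_arcs eP [x0 [y0 xy0]].
have e_bip u v : e u v -> (u \in U) = (v \notin U) by case/eP.
have e_sym : symmetric e.
  suff sub u v : e u v -> e v u by move=> u v; apply/idP/idP; exact: sub.
  move=> /eP[uv [A IA [Au Av]]]; apply/eP; split; last by exists A.
  by rewrite uv negbK.
have nbrU x v : x \notin U -> e x v -> v \in U.
  by move=> /negbTE xU /e_bip; rewrite xU => /esym/negbFE.
wlog x0U : x0 y0 xy0 / x0 \notin U.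
  move=> wl; case: (boolP (x0 \in U)) => x0U; last exact: wl xy0 x0U.
  by apply: (wl y0 x0); rewrite -?(e_bip _ _ xy0) // e_sym.
have [[p [x [y1 [pU xU xy1 xp]]]]|complete] :=
    pselect (exists p x y, [/\ p \in U, x \notin U, e x y & ~~ e x p]); last first.
  have [] := rare_neighbour e_sym e_bip x0U xy0 xy0.
  (* Here y = z = [y0]; a vertex u with neighbour v in U but not adjacent to [y0] would contradict
     [complete]. *)
  - move=> u v xv uv; have vU := nbrU _ _ x0U xv; have yU := nbrU _ _ x0U xy0.
    apply/orP; left; apply: contraT => uy; case: complete.
    by exists y0, u, v; split=> //; rewrite (e_bip _ _ uv) vU.
  - by exists y0 => //; exact: nbrU xy0.
  - by exists y0 => //; exact: nbrU xy0.
have pi2 : 0 < pi *+ 2 :> R by rewrite mulrn_wgt0 // pi_gt0.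
have [a _ pa] := circle_point_surj 0 (V_circle _ (valP p)).
(* The circle is cut at p: each vertex gets its angle in one full turn starting at the angle a of
   p. *)
have /choice[theta thetaP] (v : V) : exists t,
    [/\ a <= t < a + pi *+ 2, val v = circle_point t & v = p -> t = a].
  have [->|vp] := eqVneq v p; first by exists a; split; rewrite // lexx ltrDl.
  have [t ta vt] := circle_point_surj a (V_circle _ (valP v)).
  by exists t; split=> // vp'; rewrite vp' eqxx in vp.
pose arcs := [set val @^-1` A | A in I] : set (set V).
have eP' u v : e u v <-> (u \in U) = (v \notin U) /\
    exists2 A, arcs A & A u /\ A v.
  split=> [/eP[uv [A IA Auv]]|[uv [_ [A IA <-] Auv]]].
    by split=> //; exists (val @^-1` A) => //; exists A.
  by apply/eP; split=> //; exists A.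
have dich A u v : arcs A -> A u -> A v -> (theta u <= theta v)%O ->
    (forall q, (theta u <= theta q <= theta v)%O -> A q) \/
    (forall q, (theta q <= theta u)%O \/ (theta v <= theta q)%O -> A q).
  move=> [B IB <-] /= Bu Bv uv.
  have [/andP[au _] uE _] := thetaP u; have [/andP[_ va] vE _] := thetaP v.
  rewrite uE in Bu; rewrite vE in Bv.
  have [h|h] := circle_arc_dichotomy (I_arcs _ IB) Bu Bv au uv va.
    by left=> q quv; have [_ -> _] := thetaP q; exact: h.
  by right=> q quv; have [qa -> _] := thetaP q; exact: h.
have [y xy y_min] := arg_minP theta xy1.
have [z xz z_max] := arg_maxP theta xy1.
have cov : forall u v, e x v -> e u v -> e u y || e u z.
  apply: (extreme_neighbours_cover (p := p) dich eP' xU) xy xz _ => //.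
  - move=> q; have [_ _ /(_ erefl) ->] := thetaP p.
    by have [/andP[]] := thetaP q.
  (* As x and p are in opposite classes, a common arc would make them adjacent. *)
  - move=> A FA Ax Ap; move/negP: xp; apply; apply/eP'; split; last by exists A.
    by rewrite pU (negbTE xU).
  - by move=> v xv; apply/andP; split; [exact: y_min|exact: z_max].
have [yr|zr] := rare_neighbour e_sym e_bip xU xy xz cov.
  by exists y => //; exact: nbrU xy.
by exists z => //; exact: nbrU xz.
Qed.

Local Close Scope ring_scope.
Local Close Scope classical_set_scope.

Theorem theorem11 (R : realType) (V : {fset R * R}) (I : set (set (R * R)))
    (U W : {set V})
    (V_circle : forall p : R * R, p \in V -> circle p)
    (I_arcs : forall A : set (R * R), I A -> circle_arc A)
    (UW_cover : (U :|: W = [set: V])%SET)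
    (UW_disjoint : [disjoint U & W])
    (has_edge : exists x y : V, bipartitioned_circular_interval_adj I U W x y) :
  (exists2 u : V, u \in U &
     in_at_most_half (bipartitioned_circular_interval_adj I U W) u) /\
  (exists2 w : V, w \in W &
     in_at_most_half (bipartitioned_circular_interval_adj I U W) w).
Proof.
have WE v : (v \in W) = (v \notin U).
  have := finset.in_setT v; rewrite -UW_cover inE.
  by case: (boolP (v \in U)) => [/(disjointFr UW_disjoint)|].
have eP u v : bipartitioned_circular_interval_adj I U W u v <->
    (u \in U) = (v \notin U) /\ exists2 A, I A & A (val u) /\ A (val v).
  rewrite /bipartitioned_circular_interval_adj /del_class_edges.
  rewrite /circular_interval_adj !WE; split.
    by move=> /and3P[/andP[_ /asboolP]]; case: (u \in U); case: (v \in U).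
  move=> [uv h]; apply/and3P; split; last by rewrite uv; case: (v \in U).
    apply/andP; split; last exact/asboolP.
    by apply/eqP => uv'; move: uv; rewrite uv'; case: (v \in U).
  by rewrite uv; case: (v \in U).
(* W is the complement of U, so the adjacency criterion [eP] reads the same for both classes. *)
split; apply: (rare_vertex_in_class V_circle I_arcs _ has_edge) => // u v.
rewrite eP !WE; split=> -[uv h]; split=> //.
  by rewrite uv.
by apply: negb_inj; rewrite uv.
Qed.
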